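(* For each $n\geq 5$, the full transformation monoid $T_n$ of all maps $\{1,\ldots,n\}\to\{1,\ldots,n\}$ (under composition) is congruentially simple.
   Context: For a monoid $M$ with identity $1$, $U(M)$ denotes its group of units (elements with a two-sided inverse). A groupal submonoid of $M$ is a submonoid $S\subseteq M$ such that $x^{-1}\in S$ for every $x\in S\cap U(M)$. For $A\subseteq M$ and $x,y\in M$, $xAy=\{xay : a\in A\}$. A subset $A\subseteq M$ is invariant if for each $x,y\in M$ the following three conditions are equivalent: (i) $xAy\subseteq A$; (ii) $xy\in A$; (iii) $(xAy)\cap A\neq\emptyset$. A normal submonoid of $M$ is a submonoid which is both groupal and invariant. For a normal submonoid $S$ of $M$, $R_S$ is the smallest congruence on $M$ containing $\{1\}\times S$; the monoids $M/R_S$, for $S$ a normal submonoid of $M$, are the normal quotients of $M$. A congruence on a monoid is unital if the class of the identity element is $\{1\}$; it is non-trivial if it is not the equality relation. A monoid $M$ is called congruentially simple if its only normal quotient having non-trivial unital congruences is $M$ as normal quotient of itself (the case $S=\{1\}$); that is, for every normal submonoid $S\neq\{1\}$ the only unital congruence on $M/R_S$ is equality (equivalently, for every normal submonoid $S\neq\{1\}$ there is a unique congruence $R$ on $M$ with $[1]_R=S$). *)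

(* Defs.v *)
From HB Require Import structures.
#[warning="-notation-overridden"]
From mathcomp Require Import all_boot.
From mathcomp Require Import generic_quotient boolp classical_sets.

Set Implicit Arguments.
Unset Strict Implicit.
Unset Printing Implicit Defensive.

Import Algebra.
Local Open Scope classical_set_scope.
Local Open Scope group_scope.
Local Open Scope quotient_scope.

Section Submonoids.
Variable M : monoidType.
Implicit Types (A S : set M) (x y : M).

Definition two_sided_inverse x y := x * y = 1 /\ y * x = 1.

Definition submonoid S :=
  S 1 /\ forall x y, S x -> S y -> S (x * y).

(* [S x] together with a two-sided inverse [y] of [x] is [x \in S :&: U(M)];
   the inverse is unique, so [y] is x^-1. *)
Definition groupal S :=
  forall x y, S x -> two_sided_inverse x y -> S y.

Definition translate x A y : set M := [set x * a * y | a in A].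

Definition invariant_set A :=
  forall x y,
    (translate x A y `<=` A <-> A (x * y)) /\
    (A (x * y) <-> translate x A y `&` A !=set0).

Definition normal_submonoid S :=
  [/\ submonoid S, groupal S & invariant_set S].

End Submonoids.

Section Congruences.
Variable M : monoidType.

Record is_congruence (R : set (M * M)) : Prop := IsCongruence {
  cong_refl : forall x, R (x, x);
  cong_sym : forall x y, R (x, y) -> R (y, x);
  cong_trans : forall x y z, R (x, y) -> R (y, z) -> R (x, z);
  cong_mul : forall x x' y y', R (x, x') -> R (y, y') -> R (x * y, x' * y')
}.

Definition unital (R : set (M * M)) := [set x | R (1, x)] = [set 1].

Record congruence := Congruence {
  cong_set : set (M * M);
  congP : is_congruence cong_set
}.

Lemma smallest_is_congruence (G : set (M * M)) :
  is_congruence (smallest is_congruence G).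
Proof.
split.
- by move=> x R [/cong_refl].
- by move=> x y Rxy R RP; apply: (cong_sym RP.1); exact: Rxy.
- move=> x y z Rxy Ryz R RP.
  by apply: (cong_trans RP.1 (y := y)); [exact: Rxy|exact: Ryz].
- move=> x x' y y' Rx Ry R RP.
  by apply: (cong_mul RP.1); [exact: Rx|exact: Ry].
Qed.

Definition normal_cong (S : set M) : congruence :=
  Congruence (smallest_is_congruence ([set 1] `*` S)).

End Congruences.

Section Quotient.
Variables (M : monoidType) (R : congruence M).

Definition cong_rel : rel M := fun x y => `[< cong_set R (x, y) >].

Lemma cong_rel_refl : reflexive cong_rel.
Proof. by move=> x; apply/asboolP; exact: (cong_refl (congP R)). Qed.

Lemma cong_rel_sym : symmetric cong_rel.
Proof.
by move=> x y; apply/asboolP/asboolP; exact: (cong_sym (congP R)).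
Qed.

Lemma cong_rel_trans : transitive cong_rel.
Proof.
move=> y x z /asboolP Rxy /asboolP Ryz; apply/asboolP.
exact: (cong_trans (congP R) Rxy Ryz).
Qed.

Canonical cong_equiv_rel :=
  EquivRel cong_rel cong_rel_refl cong_rel_sym cong_rel_trans.

Definition quotient_monoid : Type := {eq_quot cong_rel}.

HB.instance Definition _ := Choice.on quotient_monoid.
HB.instance Definition _ := EqQuotient.on quotient_monoid.

Local Notation Q := quotient_monoid.
Local Notation cls x := (\pi_Q x).

Definition quotient_one : Q := cls 1.
Definition quotient_mul (a b : Q) : Q := cls (repr a * repr b).

Lemma pi_eqP (x y : M) : cls x = cls y <-> cong_set R (x, y).
Proof.
split=> [/eqP|Rxy]; first by rewrite piE => /asboolP.
by apply/eqP; rewrite piE; apply/asboolP.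
Qed.

Lemma pi_surj (a : Q) : exists x : M, a = cls x.
Proof. by exists (repr a); rewrite reprK. Qed.

Lemma quotient_mulE (x y : M) :
  quotient_mul (cls x) (cls y) = cls (x * y).
Proof.
by apply/pi_eqP; apply: (cong_mul (congP R)); apply/pi_eqP; rewrite reprK.
Qed.

Lemma quotient_mulA : associative quotient_mul.
Proof.
move=> a b c; have [x ->] := pi_surj a; have [y ->] := pi_surj b.
by have [z ->] := pi_surj c; rewrite 4!quotient_mulE mulgA.
Qed.

Lemma quotient_mul1g : left_id quotient_one quotient_mul.
Proof. by move=> a; have [x ->] := pi_surj a; rewrite quotient_mulE mul1g. Qed.

Lemma quotient_mulg1 : right_id quotient_one quotient_mul.
Proof. by move=> a; have [x ->] := pi_surj a; rewrite quotient_mulE mulg1. Qed.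

HB.instance Definition _ :=
  isMonoid.Build quotient_monoid quotient_mulA quotient_mul1g quotient_mulg1.

End Quotient.

Definition congruentially_simple (M : monoidType) :=
  forall S : set M, normal_submonoid S -> S <> [set 1] ->
  forall R : set (quotient_monoid (normal_cong S)
                  * quotient_monoid (normal_cong S)),
    is_congruence R -> unital R -> R = diagonal.

Section FullTransformationMonoid.
Variable n : nat.

Definition full_transformation : Type := {ffun 'I_n -> 'I_n}.

HB.instance Definition _ := Finite.on full_transformation.

Definition transf_one : full_transformation := [ffun i => i].
Definition transf_mul (f g : full_transformation) : full_transformation :=
  [ffun i => f (g i)].

Lemma transf_mulA : associative transf_mul.
Proof. by move=> f g h; apply/ffunP=> i; rewrite !ffunE. Qed.

Lemma transf_mul1g : left_id transf_one transf_mul.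
Proof. by move=> f; apply/ffunP=> i; rewrite !ffunE. Qed.

Lemma transf_mulg1 : right_id transf_one transf_mul.
Proof. by move=> f; apply/ffunP=> i; rewrite !ffunE. Qed.

HB.instance Definition _ :=
  isMonoid.Build full_transformation transf_mulA transf_mul1g transf_mulg1.

End FullTransformationMonoid.

(* Main.v *)
(** Let [~] be a congruence on T_n with [1 ~ s] for some [s <> 1].  Write e for
    the idempotent sending m to p and fixing every other point.  For suitable
    p, m and k <> l different from m, the map e s e, which is congruent to
    e e = e, identifies k and l.  A map [f] whose image misses a point is fixed
    on the left by a conjugate of e, and if [f] is not constant this conjugate
    can be chosen so that the corresponding conjugate of e s e identifies two
    points of the image of [f].  Hence [f] is congruent to a map of smaller
    rank, and so to a constant; all constants are congruent since
    [c_i ~ s c_i = c_(s i)].  Thus R_S identifies all singular maps as soon as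
    [S <> {1}], and a unital congruence on the quotient cannot relate the class
    of a unit to another class. *)
Require Import Defs.
#[warning="-notation-overridden"]
From mathcomp Require Import all_boot.
From mathcomp Require Import fingroup perm boolp classical_sets.

Set Implicit Arguments.
Unset Strict Implicit.
Unset Printing Implicit Defensive.

Local Open Scope group_scope.

Section SingularMaps.
Variable n : nat.
Local Notation T := (full_transformation n).

Lemma transf_mulE (f g : T) (i : 'I_n) : (f * g) i = f (g i).
Proof. by rewrite [f * g]/(transf_mul f g) ffunE. Qed.

Lemma transf_oneE (i : 'I_n) : (1 : T) i = i.
Proof. by rewrite [1]/(transf_one n) ffunE. Qed.

Lemma transf_injective_unit (f : T) :
  injective f -> exists g : T, two_sided_inverse f g.
Proof.
move=> f_inj; exists [ffun i => invF f_inj i].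
by split; apply/ffunP => i; rewrite transf_mulE transf_oneE ffunE ?f_invF ?invF_f.
Qed.

Lemma transf_noninjective (f : T) :
  ~ injective f -> exists i j, i != j /\ f i = f j.
Proof.
move=> /injectiveP /injectivePn [i [j ij fij]].
by exists i, j.
Qed.

Definition const_transf (i : 'I_n) : T := [ffun=> i].

Definition collapse (p m : 'I_n) : T := [ffun i => if i == m then p else i].

Definition transf_of_perm (s : 'S_n) : T := [ffun i => s i].

(** A product of three transpositions: each puts one more point in place and fixes the targets
    already reached, by injectivity of the partial product. *)
Lemma perm_moving3 (m k l m' k' l' : 'I_n) :
  m != k -> m != l -> k != l -> m' != k' -> m' != l' -> k' != l' ->
  exists s : 'S_n, [/\ s m = m', s k = k' & s l = l'].
Proof.
move=> mk ml kl mk' ml' kl'.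
pose s1 := tperm m m'; pose s2 := s1 * tperm (s1 k) k'.
have s1m : s1 m = m' by rewrite tpermL.
have s2k : s2 k = k' by rewrite permM tpermL.
have s2m : s2 m = m'.
  by rewrite permM s1m tpermD // -?s1m ?(inj_eq perm_inj) 1?eq_sym // s1m.
exists (s2 * tperm (s2 l) l'); split.
- by rewrite permM s2m tpermD // -?s2m ?(inj_eq perm_inj) 1?eq_sym // s2m.
- by rewrite permM s2k tpermD // -?s2k ?(inj_eq perm_inj) 1?eq_sym // s2k.
- by rewrite permM tpermL.
Qed.

Lemma third_point (k l : 'I_n) : 2 < n -> exists m, (m != k) && (m != l).
Proof.
move=> n3; have : 0 < #|~: [set k; l]|.
  by rewrite cardsCs finset.setCK cards2 card_ord subn_gt0; case: (k != l) => //;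
     apply: ltn_trans n3.
by case/card_gt0P => m; rewrite !inE negb_or => ?; exists m.
Qed.

Lemma collapse_merging (s : T) : 2 < n -> s <> 1 ->
  exists p m k l, [/\ m != p, m != k, m != l, k != l &
    collapse p m (s k) = collapse p m (s l)].
Proof.
move=> n3 s1; have [s_inj|/transf_noninjective [k [l [kl skl]]]] :=
  pselect (injective s); last first.
  have [m /andP[mk ml]] := third_point k l n3.
  by exists k, m, k, l; rewrite skl.
have [k sk] : exists k, s k != k.
  apply/existsP; apply: contra_notT s1 => /existsPn s1.
  by apply/ffunP => i; rewrite transf_oneE; apply/eqP/negbNE.
have [l /andP[lk lsk]] := third_point k (s k) n3.
(* For injective [s] the merging is done by the collapse itself, which sends [s k] to [s l] and
   fixes [s l]. *)
exists (s l), (s k), k, l; split; rewrite ?(inj_eq s_inj) 1?eq_sym //.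
- by rewrite eq_sym.
- by rewrite !ffunE eqxx (inj_eq s_inj) (negPf lk).
Qed.

Variable R : set (T * T).
Hypothesis congR : is_congruence R.
Variable s : T.
Hypotheses (n3 : 2 < n) (s_neq1 : s <> 1) (R1s : R (1, s)).

Lemma const_transf_cong (i j : 'I_n) : R (const_transf i, const_transf j).
Proof.
have [k sk] : exists k, s k != k.
  apply/existsP; apply: contra_notT s_neq1 => /existsPn s1.
  by apply/ffunP => l; rewrite transf_oneE; apply/eqP/negbNE.
(* [x] separates [k] from [s k], so multiplying [1 ~ s] by [x] on the left and by the constant [k]
   on the right gives the constants [i] and [j]. *)
pose x : T := [ffun l => if l == k then i else j].
have -> : const_transf i = x * (1 * const_transf k).
  by apply/ffunP => l; rewrite mul1g transf_mulE !ffunE eqxx.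
have -> : const_transf j = x * (s * const_transf k).
  by apply/ffunP => l; rewrite !transf_mulE !ffunE (negPf sk).
apply: (cong_mul congR); first exact: (cong_refl congR).
by apply: (cong_mul congR) => //; exact: (cong_refl congR).
Qed.

Lemma noninjective_cong_smaller (f : T) (i j : 'I_n) :
  ~ injective f -> f i != f j ->
  exists2 g : T, R (f, g) & #|codom g| < #|codom f|.
Proof.
move=> f_ninj fij.
have [m m_f] : exists m, m \notin codom f.
  apply/existsP; apply: contra_notT f_ninj => /existsPn f_surj.
  apply/injectiveP; rewrite /injectiveb /dinjectiveb.
  apply/card_uniqP; rewrite size_map -cardE.
  by apply: eq_card => l; have := f_surj l; rewrite negbK inE => ->.
have mf l : m != f l by apply: contraNneq m_f => ->; exact: codom_f.
have [p0 [m0 [k0 [l0 [mp mk ml kl merge]]]]] := collapse_merging n3 s_neq1.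
(* Conjugation by [t] makes the collapse remove [m], a point missed by [f], and makes the merged
   pair [f i], [f j]. *)
have [t [tm ti tj]] := perm_moving3 (mf i) (mf j) fij mk ml kl.
pose e := collapse p0 m0.
have e_id l : l != m0 -> e l = l by move=> lm; rewrite ffunE (negPf lm).
have tf l : t (f l) != m0 by rewrite -tm (inj_eq perm_inj) eq_sym mf.
pose u := transf_of_perm t^-1; pose v := transf_of_perm t.
pose h : T := u * e * s * (e * v).
(* The factor [1] is kept explicit: replacing it by [s] yields [h * f]. *)
have fE : f = u * e * 1 * (e * v) * f.
  by apply/ffunP => l; rewrite mulg1 !transf_mulE !ffunE !(negPf (tf l)) permK.
exists (h * f).
  suff : R (u * e * 1 * (e * v) * f, h * f) by rewrite -fE.
  apply: (cong_mul congR); last exact: (cong_refl congR).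
  apply: (cong_mul congR); last exact: (cong_refl congR).
  by apply: (cong_mul congR) => //; exact: (cong_refl congR).
have hij : h (f i) = h (f j).
  rewrite !transf_mulE ![v _]ffunE ti tj.
  by rewrite (e_id k0) 1?eq_sym // (e_id l0) 1?eq_sym // [e (s k0)]merge.
have /fintype.subsetP/subset_leq_card rank_le :
    {subset codom (h * f) <= [seq h y | y in [predD1 codom f & f j]]}.
  move=> y /codomP [l ->]; rewrite transf_mulE.
  have [flj|flj] := eqVneq (f l) (f j).
    by rewrite flj -hij; apply: fintype.image_f; rewrite !inE fij codom_f.
  by apply: fintype.image_f; rewrite !inE flj codom_f.
apply: leq_ltn_trans (leq_trans rank_le (leq_image_card _ _)) _.
by rewrite [X in _ < X](cardD1 (f j)) codom_f.
Qed.

Lemma noninjective_cong_const (f : T) (a : 'I_n) :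
  ~ injective f -> R (f, const_transf a).
Proof.
have [r] := ubnP #|codom f|; elim: r f => // r IHr f fr f_ninj.
have [/existsP [i /existsP [j fij]]|f_const] :=
  boolP [exists i, exists j, f i != f j].
  have [g Rfg gf] := noninjective_cong_smaller f_ninj fij.
  apply: (cong_trans congR Rfg); apply: IHr; first exact: leq_trans gf fr.
  (* An injective [g] would have full rank, hence not a rank below that of [f]. *)
  by move=> g_inj; move: gf; rewrite (card_codom g_inj) ltnNge max_card.
suff -> : f = const_transf (f a) by exact: const_transf_cong.
apply/ffunP => i; rewrite ffunE; apply/eqP; apply: contraNT f_const => fia.
by apply/existsP; exists i; apply/existsP; exists a.
Qed.

Lemma noninjective_cong (f g : T) :
  ~ injective f -> ~ injective g -> R (f, g).
Proof.
move=> f_ninj g_ninj; pose a := Ordinal (ltn_trans (ltn0Sn 1) n3).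
apply: (cong_trans congR (noninjective_cong_const a f_ninj)).
exact/(cong_sym congR)/noninjective_cong_const.
Qed.

End SingularMaps.

(** Multiplying by the inverse [x'] relates the identity class to that of [x' * y]; unitality makes
    these equal, and multiplying back by [x] gives the claim. *)
Lemma unital_cong_unit (M : monoidType) (R : congruence M)
    (Q : set (quotient_monoid R * quotient_monoid R)) (x x' y : M) :
  is_congruence Q -> unital Q -> two_sided_inverse x x' ->
  Q (\pi_(quotient_monoid R) x, \pi_(quotient_monoid R) y)%qT ->
  (\pi_(quotient_monoid R) x = \pi_(quotient_monoid R) y)%qT.
Proof.
move=> congQ unitalQ [xx' x'x] Qxy.
pose cl z : quotient_monoid R := (\pi_(quotient_monoid R) z)%qT.
have clM a b : cl a * cl b = cl (a * b) by exact: quotient_mulE.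
have : Q (cl x' * cl x, cl x' * cl y).
  by apply: (cong_mul congQ) => //; exact: (cong_refl congQ).
rewrite !clM x'x => Q1.
have : [set z | Q (1, z)]%classic (cl (x' * y)) by exact: Q1.
rewrite unitalQ => /= x'y.
by rewrite -/(cl x) -/(cl y) -[y]mul1g -xx' -mulgA -clM x'y mulg1.
Qed.

Theorem corollary3p20 (n : nat) (hn : 5 <= n) :
  congruentially_simple (full_transformation n).
Proof.
move=> S [[S1 _] _ _] S_neq1 Q congQ unitalQ.
have [s Ss s_neq1] : exists2 s, S s & s <> 1.
  apply: contrapT => noS; apply: S_neq1; apply/seteqP; split=> [x Sx|x ->//].
  by apply: contrapT => x1; apply: noS; exists x.
have R1s : cong_set (normal_cong S) (1, s).
  by move=> R [_]; apply; split.
apply/seteqP; split=> [[a b] /= Qab|[a b]]; last first.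
  by rewrite /diagonal /= => ->; exact: (cong_refl congQ).
rewrite /diagonal /=; have [x ax] := pi_surj a; have [y yb] := pi_surj b.
move: Qab; rewrite {}ax {}yb => Qxy.
have [/transf_injective_unit [x' xx']|x_ninj] := pselect (injective x).
  exact: unital_cong_unit xx' Qxy.
have [/transf_injective_unit [y' yy']|y_ninj] := pselect (injective y).
  exact/esym/(unital_cong_unit congQ unitalQ yy')/(cong_sym congQ).
(* Only two non-injective maps remain, and their classes already coincide in the quotient, whatever
   [Q] is. *)
apply/pi_eqP.
have n3 : 2 < n by exact: leq_trans hn.
exact: (noninjective_cong (congP (normal_cong S)) n3 s_neq1 R1s).
Qed.
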